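(* Let $P$ be a countable meet-continuous dcpo with binary meets, and let $(p_n)_{n\in\mathbb N}$ be an ascending sequence $p_0\le p_1\le\cdots$ in $P$ with supremum $r$. For every nonempty $S\subseteq\mathord{\downarrow}r$, there exist $t\in S$ and $m\in\mathbb N$ such that \[ \{y\in S:\ y\wedge p_m=t\wedge p_m\}=\{t\}. \]
   Context: All posets and directed sets are nonempty; countable sets may be finite; $\mathbb N=\{0,1,2,\ldots\}$. A subset $D$ of a poset is directed if any two of its elements have a common upper bound in $D$. A dcpo is a poset in which every directed subset has a supremum. Write $\mathord{\downarrow}x=\{y:y\le x\}$ and $\mathord{\downarrow}A=\bigcup_{a\in A}\mathord{\downarrow}a$. An upper set $U\subseteq P$ is Scott open if for every directed $D\subseteq P$, $\bigvee D\in U$ implies $D\cap U\neq\emptyset$; the Scott open sets form the Scott topology $\sigma(P)$. A dcpo $P$ is meet-continuous if for every $x\in P$ and every directed $D\subseteq P$, $x\le\bigvee D$ implies $x\in\operatorname{cl}_{\sigma(P)}(\mathord{\downarrow}x\cap\mathord{\downarrow}D)$, where $\operatorname{cl}_{\sigma(P)}$ is closure in the Scott topology. $x\wedge y$ denotes the binary meet (greatest lower bound) in $P$. *)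

(* Defs.v *)
From HB Require Import structures.
From mathcomp Require Import all_boot all_order.
From mathcomp Require Import mathcomp_extra boolp classical_sets functions.
From mathcomp Require Import cardinality filter topology.

Set Implicit Arguments.
Unset Strict Implicit.
Unset Printing Implicit Defensive.

Import Order.TTheory.

Local Open Scope order_scope.
Local Open Scope classical_set_scope.

Section ScottTopology.
Context {d : Order.disp_t} {P : porderType d}.
Implicit Types (x y s : P) (A D U : set P).

Definition directed D :=
  D !=set0 /\
  forall x y, D x -> D y -> exists z, [/\ D z, x <= z & y <= z].

Definition upper_set U := forall x y, U x -> x <= y -> U y.

(* In a poset that is not a dcpo, the condition only concerns those directed
   sets that have a supremum. *)
Definition scott_open U :=
  upper_set U /\
  forall D s, directed D -> isLub D s -> U s -> D `&` U !=set0.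

Lemma scott_openT : scott_open setT.
Proof.
split=> // D s [[x Dx] _] _ _; by exists x.
Qed.

Lemma scott_openI : setI_closed scott_open.
Proof.
move=> U V [upU oU] [upV oV]; split.
  by move=> x y [Ux Vx] xy; split; [exact: upU xy|exact: upV xy].
move=> D s dD Ds [Us Vs].
have [x [Dx Ux]] := oU _ _ dD Ds Us; have [y [Dy Vy]] := oV _ _ dD Ds Vs.
have [z [Dz xz yz]] := dD.2 _ _ Dx Dy.
by exists z; split=> //; split; [exact: upU xz|exact: upV yz].
Qed.

Lemma scott_open_bigcup (I : Type) (f : I -> set P) :
  (forall i, scott_open (f i)) -> scott_open (\bigcup_i f i).
Proof.
move=> of_; split.
  by move=> x y [i _ fix_] xy; exists i => //; exact: (of_ i).1 xy.
move=> D s dD Ds [i _ fis].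
by have [x [Dx fx]] := (of_ i).2 _ _ dD Ds fis; exists x; split=> //; exists i.
Qed.

End ScottTopology.

(* An alias of P, so that the Scott topology does not compete with another
   topology that may be attached to P. *)
Definition scott d (P : porderType d) : Type := P.

HB.instance Definition _ d (P : porderType d) := Choice.on (scott P).
HB.instance Definition _ d (P : porderType d) :=
  isOpenTopological.Build (scott P)
    (@scott_openT d P) (@scott_openI d P) (@scott_open_bigcup d P).

Lemma open_scottE d (P : porderType d) (U : set (scott P)) :
  open U = scott_open (U : set P).
Proof.
rewrite propeqE; split=> [|oU]; last first.
  by rewrite openE => x Ux; exists U; split.
rewrite openE => oU.
have -> : U = \bigcup_(B : {B : set P | scott_open B /\ B `<=` U}) sval B.
  apply/seteqP; split=> x.
    by move=> /oU [B [oB Bx BU]]; exists (exist _ B (conj oB BU)).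
  by move=> [[B [oB BU]] _ /=]; exact: BU.
by apply: scott_open_bigcup => -[B []].
Qed.

Definition is_dcpo d (P : porderType d) :=
  forall D : set P, directed D -> exists s, isLub D s.

Definition meet_continuous d (P : porderType d) :=
  forall (x : P) (D : set P) (s : P), directed D -> isLub D s -> x <= s ->
    closure ([set y : P | y <= x] `&` down D : set (scott P)) x.

(* Main.v *)
(* By meet-continuity an element y below r is determined by its traces y /\ p_n,
   and every coherent sequence of traces comes from an element below r. So the
   elements below r form a complete ultrametric space, in which the sets
   {y : y /\ p_m = t /\ p_m} are the balls. If S had no isolated point, a
   Cantor diagonalisation along an enumeration of P would yield a Cauchy
   sequence in S whose limit is none of the enumerated elements. *)
Require Import Defs.
From mathcomp Require Import all_boot all_order.
From mathcomp Require Import boolp classical_sets cardinality.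
From mathcomp Require Import topology.
Import Order.TTheory.

Local Open Scope order_scope.
Local Open Scope classical_set_scope.

Lemma scott_open_not_le (d : Order.disp_t) (P : porderType d) (u : P) :
  scott_open [set y : P | ~ y <= u].
Proof.
split=> [x y /= xNu xy yu|D s _ [_ s_least] /= sNu].
  by apply: xNu; exact: le_trans xy yu.
apply: contrapT => DU; apply: sNu; apply: s_least => z Dz.
by apply: contrapT => zNu; apply: DU; exists z.
Qed.

(** If [x] were not below [u], the Scott open set of elements not below [u] would be a neighbourhood
    of [x], hence contain some [y] below both [x] and some [z] in [D]; but then [y] is below the
    meet of [x] and [z], hence below [u]. *)
Lemma meet_continuous_le (d : Order.disp_t) (P : meetSemilatticeType d)
    (D : set P) (s x u : P) :
  meet_continuous P -> directed D -> isLub D s -> x <= s ->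
  (forall z, D z -> (x `&` z)%O <= u) -> x <= u.
Proof.
move=> mcP dD Ds xs Du; apply: contrapT => xNu.
have nbhs_x : nbhs (x : scott P) [set y : P | ~ y <= u].
  apply: (@open_nbhs_nbhs (scott P)); split=> //.
  by rewrite open_scottE; exact: scott_open_not_le.
have [y [[/= yx [z [Dz yz]]] yNu]] := mcP x D s dD Ds xs _ nbhs_x.
apply: yNu.
by apply: le_trans (Du z Dz); rewrite lexI yx.
Qed.

Lemma homo_directed (d : Order.disp_t) (P : porderType d) (a : nat -> P) :
  {homo a : m n / (m <= n)%N >-> m <= n} -> directed (range a).
Proof.
move=> a_homo; split; first by exists (a 0%N); exists 0%N.
move=> _ _ [m _ <-] [n _ <-]; exists (a (maxn m n)).
by split; [exists (maxn m n)|exact/a_homo/leq_maxl|exact/a_homo/leq_maxr].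
Qed.

Section Traces.
Context {d : Order.disp_t} {P : meetSemilatticeType d}.
Hypothesis P_meet_continuous : meet_continuous P.
Variables (p : nat -> P) (r : P).
Hypothesis p_homo : {homo p : m n / (m <= n)%N >-> m <= n}.
Hypothesis r_sup : isLub (range p) r.

Lemma trace_le (x y : P) :
  x <= r -> (forall n, (x `&` p n)%O <= y) -> x <= y.
Proof.
move=> xr xy; apply: meet_continuous_le r_sup xr _ => //.
  exact: homo_directed.
by move=> _ [n _ <-].
Qed.

Lemma trace_eqW (x y : P) m n :
  (m <= n)%N -> (x `&` p n)%O = (y `&` p n)%O ->
  (x `&` p m)%O = (y `&` p m)%O.
Proof.
by move=> mn xy; rewrite -(meet_idPr (p_homo _ _ mn)) !meetA xy.
Qed.

(** Agreement at one level passes down to all lower ones, so a separating level can be taken as high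
    as desired. *)
Lemma trace_separated (x y : P) n : x <= r -> y <= r -> x <> y ->
  exists2 m, (n < m)%N & (x `&` p m)%O <> (y `&` p m)%O.
Proof.
move=> xr yr xNy; apply: contrapT => noSep; apply: xNy.
have xy m : (x `&` p m)%O = (y `&` p m)%O.
  apply: contrapT => xNy; apply: noSep; exists (maxn m n.+1).
    exact: leq_maxr.
  by move=> /(trace_eqW _ _ m _ (leq_maxl _ _)).
apply/le_anti/andP; split; apply: trace_le => // m.
  by rewrite xy leIl.
by rewrite -xy leIl.
Qed.

(** The traces [a n] ascend, and their supremum is the limit. *)
Lemma trace_limit (t : nat -> P) (m : nat -> nat) : is_dcpo P ->
  (forall n, (m n <= m n.+1)%N) ->
  (forall n, (t n.+1 `&` p (m n))%O = (t n `&` p (m n))%O) ->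
  exists2 x, x <= r & forall n, (x `&` p (m n))%O = (t n `&` p (m n))%O.
Proof.
move=> dcP m_step t_step; pose a n := (t n `&` p (m n))%O.
have m_homo : {homo m : i j / (i <= j)%N}
  by apply: homo_leq => //; exact: leq_trans.
have a_step n : a n <= a n.+1.
  by rewrite /a -t_step lexI leIl /= leIxr // p_homo.
have a_homo : {homo a : i j / (i <= j)%N >-> i <= j}.
  by apply: homo_leq => // y x z; exact: le_trans.
have a_trace n k : (n <= k)%N -> (t k `&` p (m n))%O = a n.
  elim: k => [|k IH]; first by rewrite leqn0 => /eqP ->.
  rewrite leq_eqVlt => /predU1P[-> //|nk].
  by rewrite -(IH nk); exact: trace_eqW (m_homo n k nk) (t_step k).
have [x x_sup] := dcP _ (homo_directed _ _ _ a_homo).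
have [x_ub x_least] := x_sup; have [r_ub _] := r_sup.
exists x.
  apply: x_least => _ [n _ <-].
  by apply: le_trans (leIr _ _) _; apply: r_ub; exists (m n).
move=> n; rewrite -/(a n); apply/le_anti/andP; split; last first.
  by rewrite lexI leIr andbT; apply: x_ub; exists n.
(* By meet-continuity it suffices to bound the meet with each [a k]: for [k >= n] use that [t k] has
   trace [a n] at level [m n], otherwise [a k <= a n]. *)
apply: meet_continuous_le (homo_directed _ _ _ a_homo) x_sup (leIl _ _) _ => //.
move=> _ [k _ <-]; have [nk|/ltnW kn] := leqP n k.
  rewrite -(a_trace n k nk) lexI leIxr ?leIl //=.
  by rewrite leIxl // leIr.
by rewrite leIxr // a_homo.
Qed.

End Traces.

Theorem lemma6p1 (d : Order.disp_t) (P : meetSemilatticeType d)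
  (P_countable : countable [set: P])
  (P_dcpo : is_dcpo P)
  (P_meet_continuous : meet_continuous P)
  (p : nat -> P) (p_ascending : forall n, p n <= p n.+1)
  (r : P) (r_sup : isLub (range p) r)
  (S : set P) (S_neq0 : S !=set0) (S_le_r : S `<=` [set y | y <= r]) :
  exists2 t, S t &
    exists m, [set y | S y /\ (y `&` p m)%O = (t `&` p m)%O] = [set t].
Proof.
have p_homo : {homo p : m n / (m <= n)%N >-> m <= n}.
  by apply: homo_leq => // y x z; exact: le_trans.
apply: contrapT => noIsolated.
have other t m : S t ->
    exists y, [/\ S y, (y `&` p m)%O = (t `&` p m)%O & y <> t].
  move=> St; apply: contrapT => noOther; apply: noIsolated; exists t => //.
  exists m; apply/seteqP; split=> [y [Sy ytm]|_ ->] //=.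
  by apply: contrapT => yNt; apply: noOther; exists y.
have /countable_injP[code code_inj] := P_countable.
(* A pair is a centre and a level, that is, a ball. The next ball must avoid the element with code
   [n] even outside [S], since the limit is only known to lie below [r]. *)
have next n (tm : P * nat) : exists tm' : P * nat, S tm.1 ->
    [/\ S tm'.1, (tm.2 <= tm'.2)%N,
        (tm'.1 `&` p tm.2)%O = (tm.1 `&` p tm.2)%O &
        forall q, q <= r -> code q = n ->
          (q `&` p tm'.2)%O <> (tm'.1 `&` p tm'.2)%O].
  case: tm => t m /=; have [St|?] := pselect (S t); last by exists (t, m).
  have [[q qr qn]|noq] := pselect (exists2 q, q <= r & code q = n); last first.
    by exists (t, m) => _; split=> // q qr qn; case: noq; exists q.
  (* The old centre serves unless it is [q] itself; then non-isolation supplies another. *)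
  have [y [Sy ytm qNy]] :
      exists y, [/\ S y, (y `&` p m)%O = (t `&` p m)%O & q <> y].
    have [y [Sy ytm yNt]] := other t m St.
    have [->|/eqP qNt] := eqVneq q t; last by exists t.
    by exists y; split=> // /esym.
  have [k mk qyk] := trace_separated P_meet_continuous p r p_homo r_sup
    q y m qr (S_le_r _ Sy) qNy.
  exists (y, k) => _; split=> //=; first exact: ltnW.
  by move=> q' _ q'n; rewrite (code_inj q' q) ?inE // q'n.
have [t0 St0] := S_neq0.
pose tm := fix tm n := if n is k.+1 then projT1 (choice (next k)) (tm k)
                       else (t0, 0%N).
have tm_next n := projT2 (choice (next n)) (tm n).
have S_tm n : S (tm n).1 by elim: n => // n /tm_next[].
have [x xr x_trace] :
    exists2 x, x <= r & forall n,
      (x `&` p (tm n).2)%O = ((tm n).1 `&` p (tm n).2)%O.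
  apply: trace_limit r_sup (fun n => (tm n).1) (fun n => (tm n).2) _ _ _ => // n.
    by have [] := tm_next n (S_tm n).
  by have [] := tm_next n (S_tm n).
(* Stage [code x] excluded [x] from the ball with index [(code x).+1], yet the limit lies in every
   ball. *)
have [_ _ _ /(_ x xr erefl)] := tm_next (code x) (S_tm (code x)).
by apply; exact: (x_trace (code x).+1).
Qed.
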